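(* Let $G$ be a bipartite graph of type $(2,n)$, i.e. a (not necessarily complete) bipartite graph whose two parts have $2$ and $n$ vertices. Then all complex roots of the Ehrhart polynomial $H_G$ of the symmetric edge polytope $P_G$ lie on the line $R=\{z\in\mathbb{C}:\operatorname{Re}(z)=-\tfrac12\}$.
   Context: For a finite simple undirected graph $G=(V,E)$, let $\mathbb{Z}^{|V|}$ be the lattice with basis $(e_v)_{v\in V}$. The symmetric edge polytope $P_G\subset\mathbb{R}^{|V|}$ is the convex hull of all vectors $e_{v_1}-e_{v_2}$ with $\{v_1,v_2\}\in E$ (both orders, so each edge contributes $\pm(e_{v_1}-e_{v_2})$). If $G$ has no edges, $P_G$ is taken to be $\{0\}$. The Ehrhart polynomial $H_G$ is the polynomial with $H_G(s)=|sP_G\cap\mathbb{Z}^{|V|}|$ for all integers $s\ge 0$. *)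

(* Defs.v *)
From HB Require Import structures.
From mathcomp Require Import all_boot all_order all_algebra.
From mathcomp Require Import complex.
From mathcomp Require Import boolp classical_sets cardinality reals convex.

Set Implicit Arguments.
Unset Strict Implicit.
Unset Printing Implicit Defensive.

Import Order.TTheory GRing.Theory Num.Theory.

Local Open Scope classical_set_scope.
Local Open Scope card_scope.
Local Open Scope ring_scope.

Record sgraph (V : finType) := SGraph {
  adj :> rel V;
  adj_sym : symmetric adj;
  adj_irr : irreflexive adj }.

Definition bipartite_of_type (V : finType) (G : sgraph V) (m n : nat) : Prop :=
  exists A : {set V},
    [/\ #|A| = m, #|(~: A)%SET| = n &
        forall u v : V, G u v -> (u \in A) != (v \in A)].

Definition convex_hull (R : realType) (E : lmodType R) (S : set E) : set E :=
  smallest (@convex_set R E) S.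

(* [R^o] rather than [R], so that {ffun V -> R^o} is an [lmodType R]. *)
Definition basis_vector (R : realType) (V : finType) (v : V) : {ffun V -> R^o} :=
  [ffun w => (w == v)%:R].

Definition edge_vectors (R : realType) (V : finType) (G : sgraph V) :
    set {ffun V -> R^o} :=
  [set x | exists u v : V, G u v /\ x = basis_vector R u - basis_vector R v].
Arguments edge_vectors R {V} G.

(* The hull of the empty set is empty, hence the separate case of a graph
   without edges. *)
Definition symmetric_edge_polytope (R : realType) (V : finType)
    (G : sgraph V) : set {ffun V -> R^o} :=
  if [exists u, exists v, G u v] then convex_hull (edge_vectors R G)
  else [set 0].
Arguments symmetric_edge_polytope R {V} G.

Definition integer_points (R : realType) (V : finType) : set {ffun V -> R^o} :=
  [set x | forall v : V, (x v : R) \is a Num.int].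
Arguments integer_points R V : clear implicits.

(* [H] is determined by this property, as a polynomial is determined by its
   values at the natural numbers. *)
Definition is_ehrhart_polynomial (R : realType) (V : finType)
    (P : set {ffun V -> R^o}) (H : {poly R[i]}) : Prop :=
  forall s : nat, exists2 k : nat,
    [set s%:R *: x | x in P] `&` integer_points R V #= `I_k &
    H.[s%:R] = k%:R.

(* Main.v *)
Require Import Defs.
From mathcomp Require Import all_boot all_order all_algebra.
From mathcomp Require Import complex reals.
From mathcomp Require Import boolp classical_sets cardinality convex.
From mathcomp Require Import interval_inference zify ring lra.

(* Let a, b be the two vertices of the first part, let k vertices of the other
   part have degree one and m have degree two.  A point of the s-th dilate of
   P_G is the divergence of a flow on the edges of cost at most s, and
   minimising the cost shows that the lattice points of s P_G correspond to the
   integer vectors y in Z^k, w in Z^m and integers u congruent to |w|_1 mod 2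
   with |y|_1 + max(|w|_1, |u|) <= s (for m = 0, just |y|_1 <= s).

   Let C_d be the Ehrhart polynomial of the d-dimensional cross-polytope.  It
   satisfies C_(d+1)(x+1) - C_(d+1)(x) = C_d(x+1) + C_d(x) and
   (d+2) C_(d+2)(x) = (2x+1) C_(d+1)(x) + (d+1) C_d(x).  The first relation
   reduces the count to k = 0 and gives H = C_k if m = 0 and
   2 H = (m+1) C_(m+k+1) - (m-1) C_(m+k-1) if m > 0.  By the second relation the
   latter is, up to a positive factor, (m+1)(2x+1) C_(m+k) + (m+2k+1) C_(m+k-1).
   As w and 1/w have real parts of the same sign, the second relation also shows
   inductively that Re (C_(d+1)(z) / C_d(z)) has the sign of Re (2z+1), so neither
   expression for H can vanish when Re (2z+1) is nonzero. *)

Set Implicit Arguments.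
Unset Strict Implicit.
Unset Printing Implicit Defensive.

Import Order.TTheory GRing.Theory Num.Theory.

Local Open Scope ring_scope.

(** * Cross-polytope polynomials *)

(** The three-term recurrence looks two steps back, so the recursion carries two consecutive
    polynomials. *)
Fixpoint cross_poly_pair (F : fieldType) (d : nat) : {poly F} * {poly F} :=
  if d is e.+1 then
    let: (p, q) := cross_poly_pair F e in
    (q, (e.+2%:R)^-1 *: (((2 *: 'X) + 1) * q + e.+1%:R *: p))
  else (1, 2 *: 'X + 1).

(* The Ehrhart polynomial of the [d]-dimensional cross-polytope. *)
Definition cross_poly (F : fieldType) (d : nat) : {poly F} :=
  (cross_poly_pair F d).1.

Section CrossPoly.
Variable F : numFieldType.
Implicit Types (x : F) (d : nat).
Local Notation C d x := (cross_poly F d).[x].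

Lemma cross_poly0 x : C 0%N x = 1.
Proof. by rewrite hornerE. Qed.

Lemma cross_poly1 x : C 1%N x = 2 * x + 1.
Proof. by rewrite /cross_poly /= !hornerE. Qed.

Lemma cross_poly_rec d x :
  d.+2%:R * C d.+2 x = (2 * x + 1) * C d.+1 x + d.+1%:R * C d x.
Proof.
rewrite /cross_poly /=; case: (cross_poly_pair F d) => p q /=.
rewrite hornerZ mulrA mulfV ?pnatr_eq0 // mul1r.
by rewrite hornerD hornerM hornerZ !hornerE.
Qed.

Lemma cross_poly_pascal d x :
  C d.+1 (x + 1) - C d.+1 x = C d (x + 1) + C d x.
Proof.
suff H : C d.+1 (x + 1) - C d.+1 x = C d (x + 1) + C d x /\
         C d.+2 (x + 1) - C d.+2 x = C d.+1 (x + 1) + C d.+1 x by case: H.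
elim: d => [|d [IH1 IH2]].
  split; first by rewrite !cross_poly0 !cross_poly1; ring.
  have n2 : (2 : F) != 0 by rewrite pnatr_eq0.
  have := cross_poly_rec 0 x; have := cross_poly_rec 0 (x + 1).
  rewrite !cross_poly0 !cross_poly1 => E1 E2.
  by apply: (mulfI n2); rewrite mulrBr E1 E2; ring.
split=> //.
have n3 : (d.+3%:R : F) != 0 by rewrite pnatr_eq0.
apply: (mulfI n3); rewrite mulrBr !cross_poly_rec.
move: (cross_poly_rec d x) (cross_poly_rec d (x + 1)) IH1 IH2.
set a0 := C d x; set b0 := C d (x + 1).
set a1 := C d.+1 x; set b1 := C d.+1 (x + 1).
set a2 := C d.+2 x; set b2 := C d.+2 (x + 1).
rewrite -[d.+3]addn1 -[d.+2]addn1 -[d.+1]addn1 !natrD.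
set n : F := d%:R => E1 E2 E3 E4.
(* The goal is a linear combination of four known identities: the two inductive hypotheses, with
   weights 2x+2 and n+1, and the recurrences at x+1 and at x. *)
apply/eqP; rewrite -subr_eq0; apply/eqP; transitivity
  ((2 * x + 2) * ((b2 - a2) - (b1 + a1)) + (n + 1) * ((b1 - a1) - (b0 + a0))
   - ((n + 1 + 1) * b2 - ((2 * (x + 1) + 1) * b1 + (n + 1) * b0))
   - ((n + 1 + 1) * a2 - ((2 * x + 1) * a1 + (n + 1) * a0))); first by ring.
by rewrite E1 E2 E3 E4; ring.
Qed.

(** Eliminating C_(d+2) by the recurrence leaves only nonnegative integer coefficients, which the
    sign argument on real parts requires. The bound on [m] makes the truncated subtraction exact. *)
Lemma cross_poly_comb m d x : (0 < m)%N -> (m <= d.+2)%N ->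
  d.+2%:R * (m.+1%:R * C d.+2 x - m.-1%:R * C d x) =
  m.+1%:R * ((2 * x + 1) * C d.+1 x) + (d.+2 * 2 - m.+1)%:R * C d x.
Proof.
case: m => // m _ md /=.
rewrite mulrBr mulrCA cross_poly_rec natrB; last by lia.
by rewrite natrM -[m.+2]addn2 -[d.+2]addn2 -[d.+1]addn1 !natrD; ring.
Qed.

End CrossPoly.

(** * Location of the roots of cross-polytope polynomials and their combinations *)

Section CrossPolyRoots.
Variable R : realType.
Implicit Types z u v w : R[i].

(* [reJ u v] is the real part of [u] times the conjugate of [v]. *)
Definition reJ u v : R :=
  complex.Re u * complex.Re v + complex.Im u * complex.Im v.

Lemma reJC u v : reJ u v = reJ v u.
Proof. by rewrite /reJ; ring. Qed.

Lemma reJDl u v w : reJ (u + v) w = reJ u w + reJ v w.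
Proof. by case: u v w => ? ? [? ?] [? ?]; rewrite /reJ /=; ring. Qed.

Lemma reJ_mull u v : reJ (u * v) v = complex.Re u * reJ v v.
Proof. by case: u v => ? ? [? ?]; rewrite /reJ /=; ring. Qed.

Lemma reJ_natl n u v : reJ (n%:R * u) v = n%:R * reJ u v.
Proof.
have -> : (n%:R : R[i]) = Complex n%:R 0 by rewrite -(rmorph_nat (real_complex R)).
by case: u v => ? ? [? ?]; rewrite /reJ /=; ring.
Qed.

Lemma reJ0l v : reJ 0 v = 0.
Proof. by case: v => ? ?; rewrite /reJ /= !mul0r addr0. Qed.

Lemma reJ_gt0 u : u != 0 -> 0 < reJ u u.
Proof.
case: u => a b; rewrite eq_complex /= negb_and /reJ /= -!expr2.
case/orP => h; first by rewrite ltr_pwDl ?sqr_ge0 // exprn_even_gt0.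
by rewrite ltr_pwDr ?sqr_ge0 // exprn_even_gt0.
Qed.

(* The quotient of consecutive cross-polytope polynomials maps each of the
   half-planes cut out by the line [Re z = -1/2] into the corresponding
   half-plane cut out by the imaginary axis. *)
Lemma cross_poly_reJ d z : complex.Re (2 * z + 1) != 0 ->
  0 < complex.Re (2 * z + 1) *
      reJ (cross_poly R[i] d.+1).[z] (cross_poly R[i] d).[z].
Proof.
set y := 2 * z + 1 => y0; have y2 : 0 < complex.Re y ^+ 2 by rewrite exprn_even_gt0.
elim: d => [|d IH].
  rewrite cross_poly0 cross_poly1 -/y /reJ /=.
  by rewrite mulr1 mulr0 addr0 -expr2.
(* After scaling by d+2 the recurrence applies: the first summand becomes (Re y)^2 |C_(d+1)(z)|^2,
   and the second is a multiple of the inductive hypothesis. As that hypothesis is strict,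
   C_(d+1)(z) is nonzero. *)
rewrite -(pmulr_rgt0 _ (ltr0Sn R d.+1)) mulrCA -reJ_natl cross_poly_rec -/y.
rewrite reJDl reJ_mull reJ_natl mulrDr mulrA -expr2 mulrCA.
rewrite reJC [X in _ + _ * (_ * X)]reJC.
rewrite ltr_pwDl //; last by rewrite mulr_ge0 // ltW // reJC.
rewrite mulr_gt0 // reJ_gt0 //; apply/eqP => E.
by move: IH; rewrite E reJ0l mulr0 ltxx.
Qed.

Lemma cross_poly_root d z : root (cross_poly R[i] d) z ->
  complex.Re (2 * z + 1) = 0.
Proof.
move=> /rootP; case: d => [|d] E.
  by move/eqP: E; rewrite cross_poly0 oner_eq0.
by apply/eqP/negP => /negP /(cross_poly_reJ d); rewrite E reJ0l mulr0 ltxx.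
Qed.

Lemma cross_poly_comb_root m d z :
    (0 < m)%N -> (m <= d.+2)%N ->
    m.+1%:R * (cross_poly R[i] d.+2).[z] = m.-1%:R * (cross_poly R[i] d).[z] ->
  complex.Re (2 * z + 1) = 0.
Proof.
move=> m0 md E; apply/eqP/negP => /negP y0.
have E' : m.+1%:R * ((2 * z + 1) * (cross_poly R[i] d.+1).[z])
      + (d.+2 * 2 - m.+1)%:R * (cross_poly R[i] d).[z] = 0.
  by rewrite -cross_poly_comb // E subrr mulr0.
move: (cross_poly_reJ d y0) E'.
move: (cross_poly R[i] d.+1).[z] (cross_poly R[i] d).[z] => u v h E1.
(* Pairing with [u] and scaling by Re (2z+1) gives (m+1) Re (2z+1)^2 |u|^2, which is positive, plus
   a term that is nonnegative by [cross_poly_reJ]; this sum cannot be 0. *)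
have := congr1 (fun t => complex.Re (2 * z + 1) * reJ t u) E1.
rewrite reJDl reJ0l mulr0 !reJ_natl reJ_mull [reJ v u]reJC => /eqP.
apply/negP; rewrite gt_eqF // mulrDr.
rewrite ltr_pwDl //; last by rewrite mulrCA mulr_ge0 // ltW.
rewrite mulrCA mulr_gt0 // mulrA -expr2 mulr_gt0 ?exprn_even_gt0 //.
by apply: reJ_gt0; apply: contraTneq h => ->; rewrite reJ0l mulr0 ltxx.
Qed.

Lemma Re_eq_opp_half z : complex.Re (2 * z + 1) = 0 -> complex.Re z = - 2^-1.
Proof.
have -> : 2 * z + 1 = z + z + 1 by ring.
by case: z => a b /= h; lra.
Qed.

End CrossPolyRoots.

(** * Sums over symmetric integer intervals *)

Section SignedSum.
Local Open Scope nat_scope.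

Fixpoint zrange (s : nat) : seq int :=
  if s is r.+1 then s%:Z :: (- s%:Z)%R :: zrange r else [:: 0%R].

Lemma mem_zrange s (x : int) : (x \in zrange s) = (`|x| <= s).
Proof. by elim: s => [|s IH] /=; rewrite !inE ?IH; lia. Qed.

Lemma zrange_uniq s : uniq (zrange s).
Proof.
elim: s => //= s ->; rewrite andbT inE !mem_zrange.
by apply/andP; split; lia.
Qed.

(** This will count the admissible biases u once the parity of |w|_1 is fixed. *)
Lemma size_zrange_parity s b :
  size [seq u <- zrange s | odd `|u| == b] = s + (odd s == b).
Proof.
elim: s => [|s IH] /=; first by case: b.
by case: (odd s) IH; case: b => /= ->; lia.
Qed.

(** If [g] counts vectors by budget, [zsum g] counts them with one more integer coordinate x,
    charged |x|. On generating series this is multiplication by (1+t)/(1-t). *)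
Definition zsum (g : nat -> nat) (s : nat) : nat :=
  \sum_(x <- zrange s) g (s - `|x|).

Lemma eq_zsum g h : g =1 h -> zsum g =1 zsum h.
Proof. by move=> e s; apply: eq_bigr => x _; rewrite e. Qed.

Lemma zsumE g s : zsum g s = g s + 2 * \sum_(i < s) g i.
Proof.
rewrite /zsum; elim: s g => [|s IH] g.
  by rewrite big_seq1 big_ord0 absz0 subn0 muln0 addn0.
rewrite !big_cons /= subnn.
(* For |x| <= s the remaining budget is (s - |x|) + 1, so the induction hypothesis applies to the
   shifted function. *)
rewrite (eq_big_seq (fun x : int => g (s - `|x|).+1)); last first.
  by move=> x; rewrite mem_zrange => h; rewrite subSn.
rewrite (IH (fun i => g i.+1)) big_ord_recl /= mulnDr.
have -> : \sum_(i < s) g (bump 0 i) = \sum_(i < s) g i.+1 by [].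
by lia.
Qed.

Lemma zsum0 g : zsum g 0 = g 0.
Proof. by rewrite zsumE big_ord0 muln0 addn0. Qed.

Lemma zsumS g s : zsum g s.+1 = zsum g s + (g s.+1 + g s).
Proof. by rewrite !zsumE big_ord_recr /=; lia. Qed.

End SignedSum.

Section CrossCount.
Variable F : numFieldType.
Local Notation C d s := (cross_poly F d).[s%:R].

Lemma cross_poly_at0 d : C d 0 = 1.
Proof.
suff H : C d 0 = 1 /\ C d.+1 0 = 1 by case: H.
elim: d => [|d [IH1 IH2]]; first by rewrite cross_poly0 cross_poly1; split=> //; ring.
split=> //; have n2 : (d.+2%:R : F) != 0 by rewrite pnatr_eq0.
by apply: (mulfI n2); rewrite cross_poly_rec IH1 IH2 -[d.+2]addn1 natrD; ring.
Qed.

(** [zsumS] and [cross_poly_pascal] are the same recursion in s, and at s = 0 every C_d equals 1.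
    Hence each [zsum] raises the dimension by one. *)
Lemma zsum_cross_poly (a b c : F) d e g :
  (forall s, a * (g s)%:R = b * C d s + c * C e s) ->
  forall s, a * (zsum g s)%:R = b * C d.+1 s + c * C e.+1 s.
Proof.
move=> H; elim=> [|s IH]; first by rewrite zsum0 H !cross_poly_at0.
rewrite zsumS !natrD !mulrDr IH !H -natr1.
have P i : (cross_poly F i.+1).[s%:R + 1] =
    C i.+1 s + ((cross_poly F i).[s%:R + 1] + C i s).
  by rewrite -cross_poly_pascal; ring.
by rewrite !P; ring.
Qed.

Lemma iter_zsum_cross_poly (a b c : F) d e g k :
  (forall s, a * (g s)%:R = b * C d s + c * C e s) ->
  forall s, a * (iter k zsum g s)%:R = b * C (k + d) s + c * C (k + e) s.
Proof. by move=> H; elim: k => [|k IH] // s; apply: zsum_cross_poly. Qed.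

Lemma iter_zsum1 d s : (iter d zsum (fun=> 1%N) s)%:R = C d s.
Proof.
have := @iter_zsum_cross_poly 1 1 0 0 0 (fun=> 1%N) d _ s.
rewrite addn0 !mul1r mul0r addr0; apply=> r.
by rewrite cross_poly0; ring.
Qed.

Lemma iter_zsum_even m s :
  2 * (iter m.+1 zsum (fun r => ~~ odd r : nat) s)%:R = C m.+1 s + C m s.
Proof.
have -> : iter m.+1 zsum (fun r => ~~ odd r : nat) s =
    iter m zsum (zsum (fun r => ~~ odd r : nat)) s by rewrite iterSr.
have := @iter_zsum_cross_poly 2 1 1 1 0 (zsum (fun r => ~~ odd r : nat)) m _ s.
rewrite addn0 addn1 !mul1r; apply=> r.
rewrite cross_poly0 cross_poly1.
(* Among the x with |x| <= r, exactly r+1 leave an even budget, and 2(r+1) = C_1(r) + C_0(r). *)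
have -> : zsum (fun r => ~~ odd r : nat) r = r.+1.
  by elim: r => [|r IH]; rewrite ?zsum0 // zsumS IH /=; case: (odd r) => /=; lia.
by rewrite -natr1; ring.
Qed.

(* With [m] vertices of degree two and [k] leaves, the iterated sum counts the
   lattice points of the [s]-th dilate. *)
Lemma count_K2_cross_poly m k s : (0 < m)%N ->
  2 * (iter k zsum (fun r => r * iter m zsum (fun=> 1) r +
                     iter m zsum (fun r => ~~ odd r : nat) r)%N s)%:R =
  m.+1%:R * C (m + k).+1 s - m.-1%:R * C (m + k).-1 s.
Proof.
case: m => // m _; rewrite -mulNr.
have -> : (m.+1 + k).+1 = (k + m.+2)%N by lia.
have -> : (m.+1 + k).-1 = (k + m)%N by lia.
apply: iter_zsum_cross_poly => r.
(* The left side is (2r+1) C_(m+1)(r) + C_m(r), which the recurrence rewrites as (m+2) C_(m+2)(r) -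
   m C_m(r). *)
rewrite natrD natrM mulrDr iter_zsum_even iter_zsum1 cross_poly_rec.
by rewrite -natr1 /=; ring.
Qed.

End CrossCount.

(** * Counting integer vectors *)

Section LatticePoints.
Variable V : finType.
Local Notation point := {ffun V -> int}.
Implicit Types (y : point) (v w : V) (l : seq V) (r s : nat).
Implicit Types (B : nat -> seq point).
Local Open Scope nat_scope.

Definition set_coord y v (x : int) : point :=
  [ffun w => if w == v then x else y w].

Definition erase l y : point := [ffun v => if v \in l then 0%R else y v].

Definition l1norm l y : nat := \sum_(v <- l) `|y v|.

(* Each coordinate in [l] is chosen freely and uses up its absolute value of
   the budget [s]; the remaining coordinates come from [B], applied to what is
   left of the budget. *)
Fixpoint points B l s : seq point :=
  if l is v :: l' then
    [seq set_coord y v x | x <- zrange s, y <- points B l' (s - `|x|)]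
  else B s.

Lemma eq_l1norm l (y z : point) : {in l, y =1 z} -> l1norm l y = l1norm l z.
Proof. by move=> e; apply: eq_big_seq => v /e ->. Qed.

Lemma set_coord_l1norm l y v x : v \notin l ->
  l1norm l (set_coord y v x) = l1norm l y.
Proof.
move=> vl; apply: eq_l1norm => w wl; rewrite ffunE.
by case: eqP => // wv; move: vl; rewrite -wv wl.
Qed.

Lemma set_coord_inj (y z : point) v (x t : int) : y v = z v ->
  set_coord y v x = set_coord z v t -> y = z /\ x = t.
Proof.
move=> yz /ffunP e; split; last by have := e v; rewrite !ffunE eqxx.
by apply/ffunP => w; have := e w; rewrite !ffunE; case: eqP => // ->.
Qed.

(** If base points are zero on [l], erasing [l] recovers the base point, so the enumeration [points]
    has no repetitions. *)
Definition vanish_on l B := forall r y, y \in B r -> {in l, forall v, y v = 0%R}.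

Lemma vanish_on_cons v l B : vanish_on (v :: l) B -> vanish_on l B.
Proof. by move=> h r y yB w wl; apply: (h _ _ yB); rewrite inE wl orbT. Qed.

Lemma mem_points B l s y : uniq l -> vanish_on l B ->
  (y \in points B l s) =
  (l1norm l y <= s) && (erase l y \in B (s - l1norm l y)).
Proof.
elim: l s y => [|v l IH] s y /=.
  move=> _ _; rewrite /l1norm big_nil subn0 /=.
  by have -> : erase [::] y = y by apply/ffunP => v; rewrite ffunE.
move=> /andP[vl ul] hB; have hB' := vanish_on_cons hB.
have consE (z : point) : l1norm (v :: l) z = `|z v| + l1norm l z.
  by rewrite /l1norm big_cons.
apply/allpairsPdep/andP => [[x [y' [xs]]]|[le_s yB]].
  rewrite mem_zrange in xs; rewrite IH // => /andP[le_s y'B] ->.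
  rewrite consE set_coord_l1norm // ffunE eqxx; split; first by lia.
  rewrite subnDA; suff -> : erase (v :: l) (set_coord y' v x) = erase l y' by [].
  apply/ffunP => w; rewrite !ffunE inE; case: eqP => [->|] //=.
  have := hB _ _ y'B v; rewrite ffunE (negPf vl) => -> //.
  by rewrite inE eqxx.
exists (y v), (set_coord y v 0%R); rewrite mem_zrange.
rewrite consE in le_s yB; split; first by lia.
  rewrite IH // set_coord_l1norm //; apply/andP; split; first by lia.
  rewrite -subnDA; suff -> : erase l (set_coord y v 0%R) = erase (v :: l) y by [].
  by apply/ffunP => w; rewrite !ffunE inE; case: (w == v); case: (w \in l).
by apply/ffunP => w; rewrite !ffunE; case: eqP => // ->.
Qed.

Lemma points_uniq B l s : uniq l -> vanish_on l B -> (forall r, uniq (B r)) ->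
  uniq (points B l s).
Proof.
move=> + + uB; elim: l s => [|v l IH] s //= /andP[vl ul] hB.
have hB' := vanish_on_cons hB.
apply: allpairs_uniq_dep; first exact: zrange_uniq.
  by move=> x _; apply: IH.
have y0 x y : y \in points B l x -> y v = 0%R.
  rewrite mem_points // => /andP[_ /hB /(_ v)].
  by rewrite ffunE (negPf vl) inE eqxx; apply.
move=> _ _ /allpairsPdep[x [y [_ yP ->]]] /allpairsPdep[x' [y' [_ y'P ->]]] /=.
by move=> /set_coord_inj[|-> -> //]; rewrite (y0 _ _ yP) (y0 _ _ y'P).
Qed.

Lemma size_points B l s :
  size (points B l s) = iter (size l) zsum (fun r => size (B r)) s.
Proof.
elim: l s => [|v l IH] s //=.
rewrite size_allpairs_dep sumnE big_map; apply: eq_bigr => x _; exact: IH.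
Qed.

Definition origin_base (r : nat) : seq point := [:: [ffun=> 0%R]].

Lemma vanish_on_origin l : vanish_on l origin_base.
Proof. by move=> r y; rewrite inE => /eqP -> v _; rewrite ffunE. Qed.

Lemma erase_origin l y :
  (erase l y == [ffun=> 0%R]) = [forall v, (v \notin l) ==> (y v == 0%R)].
Proof.
apply/eqP/forallP => [/ffunP e v|h].
  by apply/implyP => vl; have := e v; rewrite !ffunE (negPf vl) => ->.
apply/ffunP => v; rewrite !ffunE; case: ifP => // vl.
by have := h v; rewrite vl => /eqP.
Qed.

Lemma mem_points_origin l s y : uniq l ->
  (y \in points origin_base l s) =
  (l1norm l y <= s) && [forall v, (v \notin l) ==> (y v == 0%R)].
Proof.
by move=> ul; rewrite mem_points //; [rewrite inE erase_origin|exact: vanish_on_origin].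
Qed.

Lemma points_origin_uniq l s : uniq l -> uniq (points origin_base l s).
Proof. by move=> ul; apply: points_uniq => //; exact: vanish_on_origin. Qed.

Lemma count_points_parity l s : uniq l ->
  count (fun y => odd s == odd (l1norm l y)) (points origin_base l s) =
  iter (size l) zsum (fun r => ~~ odd r : nat) s.
Proof.
(* The points counted are themselves generated by [points], from a base that is
   empty when the remaining budget is odd. *)
move=> ul; pose B r := if odd r then [::] else origin_base r.
have hB : vanish_on l B.
  by move=> r y; rewrite /B; case: ifP => // _; apply: vanish_on_origin.
transitivity (size (points B l s)); last first.
  rewrite size_points; elim: (size l) s => [|k IH] s /=.
    by rewrite /B; case: (odd s).
  exact: eq_zsum.
rewrite -size_filter; apply: perm_size; apply: uniq_perm.
- by rewrite filter_uniq // points_origin_uniq.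
- by apply: points_uniq => // r; rewrite /B; case: ifP.
move=> y; rewrite mem_filter mem_points_origin // mem_points // /B.
case: leqP => le_s; rewrite ?andbF //= oddB //.
by case: (odd s); case: odd => //=; rewrite inE erase_origin.
Qed.

(** * Enumeration of the codes when there are common neighbours *)

Section CompleteBipartite.
Variables (a : V) (D L : seq V).
Hypotheses (uDL : uniq (a :: D ++ L)).

(** Here w lives on [D] and u is stored at [a]. Both get the full budget r instead of sharing it,
    which realises the bound max(|w|_1, |u|) <= r. *)
Definition K2_base (r : nat) : seq point :=
  [seq set_coord y a u | y <- points origin_base D r,
     u <- [seq u <- zrange r | odd `|u| == odd (l1norm D y)]].

Definition K2_points s := points K2_base L s.

Let uD : uniq D. Proof. by move: uDL; rewrite /= cat_uniq => /and4P[]. Qed.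
Let uL : uniq L. Proof. by move: uDL; rewrite /= cat_uniq => /and4P[]. Qed.
Let aD : a \notin D.
Proof. by move: uDL; rewrite /= mem_cat negb_or => /andP[/andP[]]. Qed.
Let aL : a \notin L.
Proof. by move: uDL; rewrite /= mem_cat negb_or => /andP[/andP[]]. Qed.
Let LD v : v \in L -> v \notin D.
Proof.
move: uDL; rewrite /= cat_uniq => /and4P[_ _ /hasPn h _]; exact: h.
Qed.

Lemma mem_K2_base r y :
  (y \in K2_base r) =
  [&& l1norm D y <= r, `|y a| <= r, odd `|y a| == odd (l1norm D y) &
      [forall v, (v \notin a :: D) ==> (y v == 0%R)]].
Proof.
apply/allpairsPdep/and4P => [[y' [u [y'P + ->]]]|[le_r ua par supp]].
  rewrite mem_filter mem_zrange set_coord_l1norm // ffunE eqxx => /andP[-> ->].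
  move: y'P; rewrite mem_points_origin // => /andP[-> /forallP h]; split=> //.
  apply/forallP => v; have := h v; rewrite inE ffunE negb_or.
  by case: (v =P a).
exists (set_coord y a 0%R), (y a); split.
- rewrite mem_points_origin // set_coord_l1norm // le_r.
  apply/forallP => v; have := forallP supp v; rewrite inE ffunE negb_or.
  by case: (v =P a); rewrite //= eqxx implybT.
- by rewrite mem_filter mem_zrange set_coord_l1norm // par ua.
by apply/ffunP => v; rewrite !ffunE; case: eqP => // ->.
Qed.

Lemma K2_base_uniq r : uniq (K2_base r).
Proof.
apply: allpairs_uniq_dep; first exact: points_origin_uniq.
  by move=> y _; rewrite filter_uniq // zrange_uniq.
have y0 y : y \in points origin_base D r -> y a = 0%R.
  rewrite mem_points_origin // => /andP[_ /forallP /(_ a)].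
  by rewrite aD => /eqP.
move=> _ _ /allpairsPdep[y [x [yP _ ->]]] /allpairsPdep[y' [x' [y'P _ ->]]] /=.
by move=> /set_coord_inj[|-> -> //]; rewrite (y0 _ yP) (y0 _ y'P).
Qed.

Let vanish_on_K2 : vanish_on L K2_base.
Proof.
move=> r y; rewrite mem_K2_base => /and4P[_ _ _ /forallP h] v vL.
have := h v; rewrite inE negb_or (LD vL) andbT.
by case: (v =P a) => [va|_ /eqP //]; move: aL; rewrite -va vL.
Qed.

Lemma K2_points_uniq s : uniq (K2_points s).
Proof. by apply: points_uniq => // r; exact: K2_base_uniq. Qed.

Lemma mem_K2_points s y :
  (y \in K2_points s) =
  [&& l1norm L y + l1norm D y <= s, l1norm L y + `|y a| <= s,
      odd `|y a| == odd (l1norm D y) &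
      [forall v, (v \notin a :: D ++ L) ==> (y v == 0%R)]].
Proof.
rewrite mem_points // mem_K2_base.
have -> : l1norm D (erase L y) = l1norm D y.
  apply: eq_l1norm => v vD; rewrite ffunE; case: ifP => // /LD.
  by rewrite vD.
rewrite ffunE (negPf aL).
have -> : [forall v, (v \notin a :: D) ==> (erase L y v == 0%R)] =
          [forall v, (v \notin a :: D ++ L) ==> (y v == 0%R)].
  apply: eq_forallb => v; rewrite ffunE !inE mem_cat.
  by case: (v \in L); rewrite ?orbT ?orbF //= eqxx implybT.
by lia.
Qed.

(** Each w admits r values of u, and one more exactly when |w|_1 has the parity of r. The two
    summands collect these contributions. *)
Lemma size_K2_base r :
  size (K2_base r) =
  r * iter (size D) zsum (fun=> 1) r +
  iter (size D) zsum (fun r => ~~ odd r : nat) r.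
Proof.
rewrite size_allpairs_dep sumnE big_map.
under eq_bigr do rewrite size_zrange_parity.
rewrite big_split /= -count_points_parity // -(size_points origin_base D r).
rewrite big_const_seq count_predT iter_addn_0 -sum1_count; congr (_ + _).
by rewrite [RHS]big_mkcond; apply: eq_bigr => y _; case: eqP.
Qed.

Lemma size_K2_points s (F : numFieldType) : D != [::] ->
  (2 * (size (K2_points s))%:R = (size D).+1%:R *
     (cross_poly F (size D + size L).+1).[s%:R] -
   (size D).-1%:R * (cross_poly F (size D + size L).-1).[s%:R])%R.
Proof.
move=> D0; rewrite -count_K2_cross_poly; last by case: D D0.
congr (2 * _%:R)%R; rewrite size_points.
elim: (size L) s => [|k IH] s /=; first exact: size_K2_base.
exact: eq_zsum.
Qed.

End CompleteBipartite.

Lemma size_points_origin l s (F : numFieldType) :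
  ((size (points origin_base l s))%:R = (cross_poly F (size l)).[s%:R])%R.
Proof. by rewrite size_points iter_zsum1. Qed.

End LatticePoints.

(** * The polytope as a flow-cost ball *)

Section Dilates.
Variables (R : realType) (E : lmodType R).
Local Open Scope classical_set_scope.
Implicit Types (Q S : set E) (r t : R) (x y : E).

Lemma convex_setE Q : convex_set Q <->
  (forall x y t, 0 <= t -> t <= 1 -> Q x -> Q y -> Q (t *: x + (1 - t) *: y)).
Proof.
split=> [cQ x y t t0 t1 Qx Qy|cQ x y l].
  have := cQ x y (Itv01 t0 t1); rewrite !inE; exact.
by rewrite !inE => Qx Qy; apply: cQ.
Qed.

Lemma convex_hull_convex S : convex_set (convex_hull S : set E).
Proof.
apply/convex_setE => x y t t0 t1 Sx Sy Q [cQ SQ].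
by apply: (convex_setE Q).1 => //; [apply: Sx|apply: Sy].
Qed.

Definition dilate Q r := [set r *: x | x in Q].

Variable Q : set E.
Hypothesis cQ : convex_set Q.

Lemma dilate_add r t x y : 0 <= r -> 0 <= t ->
  dilate Q r x -> dilate Q t y -> dilate Q (r + t) (x + y).
Proof.
move=> r0 t0 [p Qp <-] [q Qq <-].
have [e|rt0] := eqVneq (r + t) 0.
  have [-> ->] : r = 0 /\ t = 0 by lra.
  by exists p; rewrite // addr0 !scale0r addr0.
have rt : 0 < r + t by rewrite lt_neqAle eq_sym rt0 addr_ge0.
exists ((r / (r + t)) *: p + (1 - r / (r + t)) *: q).
  apply: (convex_setE Q).1 => //; first by rewrite divr_ge0 // ltW.
  by rewrite ler_pdivrMr // mul1r lerDl.
rewrite scalerDr !scalerA; congr (_ *: _ + _ *: _); by field.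
Qed.

Hypothesis Q0 : Q 0.

Lemma dilate0 r : dilate Q r 0.
Proof. by exists 0; rewrite ?scaler0. Qed.

Lemma dilate_le r t x : 0 <= r -> r <= t -> dilate Q r x -> dilate Q t x.
Proof.
move=> r0 rt Qx; rewrite -[x]addr0 -[t](subrKC r).
by apply: dilate_add; rewrite ?subr_ge0 //; apply: dilate0.
Qed.

Lemma dilate_sum (I : Type) (s : seq I) (P : pred I) (r : I -> R) (f : I -> E) :
    (forall i, P i -> 0 <= r i) -> (forall i, P i -> dilate Q (r i) (f i)) ->
  dilate Q (\sum_(i <- s | P i) r i) (\sum_(i <- s | P i) f i).
Proof.
move=> r0 h.
suff : 0 <= \sum_(i <- s | P i) r i /\
  dilate Q (\sum_(i <- s | P i) r i) (\sum_(i <- s | P i) f i) by case.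
apply: (big_ind2 (fun r x => 0 <= r /\ dilate Q r x)).
- by split; rewrite ?lexx; last exact: dilate0.
- move=> ? ? ? ? [? ?] [? ?]; split; first exact: addr_ge0.
  exact: dilate_add.
- by move=> i Pi; split; [apply: r0|apply: h].
Qed.

Lemma dilate_scale_sym t x : Q x -> Q (- x) -> dilate Q `|t| (t *: x).
Proof.
move=> Qx QNx; have [t0|t0] := leP 0 t.
  by exists x; rewrite // ger0_norm.
by exists (- x); rewrite // ltr0_norm // scaleNr scalerN opprK.
Qed.

End Dilates.

(** Take [th * n] to be the point of [-n, n] nearest to u; then the sum equals max(n, |u|). This
    splits a bias into a part carried at no extra cost and an excess. *)
Lemma clamp_exists (R : realFieldType) (n u m : R) : 0 <= n ->
  n <= m -> `|u| <= m -> exists2 th, `|th| <= 1 & n + `|u - th * n| <= m.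
Proof.
move=> n0 nm um; have [un|nu] := leP `|u| n.
  have [n00|nn0] := eqVneq n 0.
    exists 0; first by rewrite normr0.
    by move: un nm; rewrite n00 normr_le0 => /eqP ->; rewrite mulr0 subr0 normr0 addr0.
  exists (u / n); last by rewrite divfK // subrr normr0 addr0.
  by rewrite normf_div (ger0_norm n0) ler_pdivrMr ?mul1r // lt_neqAle eq_sym nn0.
have [u0|u0] := leP 0 u.
  rewrite ger0_norm // in nu um; exists 1; first by rewrite normr1.
  by rewrite mul1r ger0_norm; lra.
rewrite ltr0_norm // in nu um; exists (-1); first by rewrite normrN normr1.
by rewrite mulN1r opprK ler0_norm; lra.
Qed.

Section K2Polytope.
Variables (R : realType) (V : finType) (G : sgraph V) (a b : V).
Hypothesis ab : a != b.
Hypothesis bipG : forall u v, G u v -> (u \in [set a; b]) != (v \in [set a; b]).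
Local Notation point := {ffun V -> R^o}.
Implicit Types (x : point) (v w c : V) (S : {set V}) (r t : R).
Local Notation e v := (basis_vector R v).

Definition leaves_a : {set V} := [set v | G a v && ~~ G b v].
Definition leaves_b : {set V} := [set v | ~~ G a v && G b v].
Definition leaves : {set V} := leaves_a :|: leaves_b.
Definition common : {set V} := [set v | G a v && G b v].
Local Notation A := leaves_a.
Local Notation B := leaves_b.
Local Notation L := leaves.
Local Notation D := common.

Lemma a_notin : [/\ a \notin A, a \notin B & a \notin D].
Proof.
rewrite !inE (adj_irr G a) /=; split => //.
by apply/negP => /bipG; rewrite !inE !eqxx orbT.
Qed.

Lemma b_notin : [/\ b \notin A, b \notin B & b \notin D].
Proof.
rewrite !inE (adj_irr G b) /= !andbF andbT; split => //.
by apply/negP => /bipG; rewrite !inE !eqxx orbT.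
Qed.

Lemma sum_leaves (M : nmodType) (f : V -> M) :
  \sum_(v in L) f v = \sum_(v in A) f v + \sum_(v in B) f v.
Proof.
rewrite (big_setID A) /=; congr (_ + _); apply: eq_bigl => v.
  by rewrite !inE; case: (G a v); case: (G b v).
by rewrite !inE; case: (G a v); case: (G b v).
Qed.

(* If [x] is the divergence of a flow [f] on the edges, then [- flow_bias x] is
   the sum over the common neighbours [v] of [f (v, a) - f (v, b)]. *)
Definition flow_bias x : R :=
  2 * x a + 2 * \sum_(v in A) x v + \sum_(v in D) x v.

Definition K2_sum x : R :=
  x a + x b + \sum_(v in A) x v + \sum_(v in B) x v + \sum_(v in D) x v.

Definition l1 S x : R := \sum_(v in S) `|x v|.

(** The two inequalities together bound the cost by the maximum of the overview. Without common
    neighbours [a] and [b] lie in different components, so each star must have sum zero; given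
    [K2_sum x = 0], vanishing bias says this. *)
Definition K2_ball r x : Prop :=
  [/\ forall v, v \notin a |: (b |: (L :|: D)) -> x v = 0, K2_sum x = 0,
      D = finset.set0 -> flow_bias x = 0,
      l1 L x + l1 D x <= r & l1 L x + `|flow_bias x| <= r].

Let sumD S x y : \sum_(v in S) (x + y) v = \sum_(v in S) x v + \sum_(v in S) y v.
Proof. by rewrite -big_split; apply: eq_bigr => v _; rewrite ffunE. Qed.

Let sumZ S t x : \sum_(v in S) (t *: x) v = t * \sum_(v in S) x v.
Proof. by rewrite mulr_sumr; apply: eq_bigr => v _; rewrite ffunE. Qed.

Lemma flow_biasD x y : flow_bias (x + y) = flow_bias x + flow_bias y.
Proof. by rewrite /flow_bias !sumD ffunE; ring. Qed.

Lemma flow_biasZ t x : flow_bias (t *: x) = t * flow_bias x.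
Proof. by rewrite /flow_bias !sumZ ffunE /GRing.scale /=; ring. Qed.

Lemma K2_sumD x y : K2_sum (x + y) = K2_sum x + K2_sum y.
Proof. by rewrite /K2_sum !sumD !ffunE; ring. Qed.

Lemma K2_sumZ t x : K2_sum (t *: x) = t * K2_sum x.
Proof. by rewrite /K2_sum !sumZ !ffunE /GRing.scale /=; ring. Qed.

Lemma l1D S x y : l1 S (x + y) <= l1 S x + l1 S y.
Proof. by rewrite -big_split; apply: ler_sum => v _; rewrite ffunE ler_normD. Qed.

Lemma l1Z S t x : l1 S (t *: x) = `|t| * l1 S x.
Proof. by rewrite mulr_sumr; apply: eq_bigr => v _; rewrite ffunE normrM. Qed.

Lemma K2_ballD r t x y : K2_ball r x -> K2_ball t y -> K2_ball (r + t) (x + y).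
Proof.
move=> [x0 xT xD xN xB] [y0 yT yD yN yB]; split.
- by move=> v vN; rewrite ffunE x0 // y0 // addr0.
- by rewrite K2_sumD xT yT addr0.
- by move=> D0; rewrite flow_biasD xD // yD // addr0.
- by have := l1D L x y; have := l1D D x y; lra.
by rewrite flow_biasD; have := l1D L x y;
  have := ler_normD (flow_bias x) (flow_bias y); lra.
Qed.

Lemma K2_ballZ t r x : K2_ball r x -> K2_ball (`|t| * r) (t *: x).
Proof.
move=> [x0 xT xD xN xB]; split.
- by move=> v vN; rewrite ffunE x0 // scaler0.
- by rewrite K2_sumZ xT mulr0.
- by move=> D0; rewrite flow_biasZ xD // mulr0.
- by rewrite !l1Z -mulrDr ler_wpM2l.
by rewrite l1Z flow_biasZ normrM -mulrDr ler_wpM2l.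
Qed.

Lemma K2_ball_convex : convex_set (K2_ball 1 : classical_sets.set point).
Proof.
apply/convex_setE => x y t t0 t1 xB yB.
have := K2_ballD (K2_ballZ t xB) (K2_ballZ (1 - t) yB).
by rewrite !mulr1 !ger0_norm ?subr_ge0 // subrKC.
Qed.

Lemma edge_sum S v c : c \notin S -> \sum_(w in S) (e v - e c) w = (v \in S)%:R.
Proof.
move=> cS; have [vS|vS] := boolP (v \in S).
  rewrite (bigD1 v) //= big1 ?addr0 => [|w /andP[wS wv]].
    rewrite !ffunE eqxx; case: eqP => [vc|]; last by rewrite subr0.
    by rewrite -vc vS in cS.
  rewrite !ffunE (negPf wv); case: eqP => [wc|]; last by rewrite subrr.
  by rewrite -wc wS in cS.
apply: big1 => w wS; rewrite !ffunE.
have -> : (w == v) = false by apply: contraNF vS => /eqP <-.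
have -> : (w == c) = false by apply: contraNF cS => /eqP <-.
by rewrite subrr.
Qed.

Lemma edge_l1 S v c : c \notin S -> l1 S (e v - e c) = (v \in S)%:R.
Proof.
move=> cS; rewrite -(edge_sum v cS); apply: eq_bigr => w wS.
rewrite !ffunE; have -> : (w == c) = false by apply: contraNF cS => /eqP <-.
by rewrite subr0; case: (w == v); rewrite ?normr1 ?normr0.
Qed.

Lemma K2_ball_edge c v : c \in [set a; b] -> G c v -> K2_ball 1 (e v - e c).
Proof.
move=> cab cv.
have vL : v \in L :|: D.
  by rewrite !inE; move: cab cv; rewrite !inE => /orP[]/eqP-> ->;
     case: (G a v); case: (G b v).
have va : (a == v) = false.
  apply: contraTF cv => /eqP <-; apply/negP => /bipG.
  by rewrite cab !inE eqxx.
have vb : (b == v) = false.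
  apply: contraTF cv => /eqP <-; apply/negP => /bipG.
  by rewrite cab !inE eqxx orbT.
have [aA aB aD] := a_notin; have [bA bB bD] := b_notin.
have [cA cB cD] : [/\ c \notin A, c \notin B & c \notin D].
  by case/set2P: cab => ->.
have cL : c \notin L by rewrite finset.in_setU negb_or cA.
have LD : (v \in L)%:R + (v \in D)%:R = 1 :> R.
  move: vL; rewrite !inE; case: (G a v); case: (G b v) => //= _;
    by rewrite ?addr0 ?add0r.
have LAB : (v \in L)%:R = (v \in A)%:R + (v \in B)%:R :> R.
  by rewrite !inE; case: (G a v); case: (G b v); rewrite /= ?addr0 ?add0r.
(* An edge to a leaf has bias 0; an edge to a common neighbour has bias -1 if [c] is [a] and 1 if
   [c] is [b]. *)
have fb : `|flow_bias (e v - e c)| = (v \in D)%:R.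
  rewrite /flow_bias !edge_sum // !ffunE va sub0r.
  move: cab cv vL; rewrite !inE => /orP[]/eqP -> ->; rewrite /= ?eqxx ?(negPf ab) /=.
    by case: (G b v) => /= _;
      rewrite ?(addr0, mulr0, mulr1, mulrN1, addNr, add0r, normr0) //;
      rewrite (_ : -2 + 1 = -1) ?normrN ?normr1 //; lra.
  by case: (G a v) => /= _;
      rewrite ?(oppr0, addr0, mulr0, mulr1, addNr, add0r, normr0, normr1).
split.
- move=> w wN; rewrite !ffunE.
  have -> : (w == v) = false.
    by apply: contraNF wN => /eqP ->; rewrite !finset.in_setU in vL *; rewrite vL !orbT.
  have -> : (w == c) = false; last by rewrite subrr.
  apply: contraNF wN => /eqP ->; move: cab; rewrite !finset.in_setU !finset.in_set1.
  by move=> /orP[] ->; rewrite ?orbT.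
- rewrite /K2_sum !edge_sum // !ffunE va vb !sub0r.
  move: LD; rewrite LAB; move: cab; rewrite !inE => /orP[]/eqP ->.
    by rewrite eqxx (eq_sym b) (negPf ab) /=; lra.
  by rewrite eqxx (negPf ab) /=; lra.
- by move=> D0; apply/eqP; rewrite -normr_eq0 fb D0 inE.
- by rewrite !edge_l1 // LD.
by rewrite edge_l1 // fb LD.
Qed.

Lemma edge_vectorP x : edge_vectors R G x -> exists c v,
  [/\ c \in [set a; b], G c v & x = e v - e c \/ x = - (e v - e c)].
Proof.
move=> [u [v [uv ->]]]; have := bipG uv.
have [uab|uab] := boolP (u \in [set a; b]);
  have [vab|vab] := boolP (v \in [set a; b]) => // _.
  by exists u, v; split => //; right; rewrite opprB.
by exists v, u; split; [|rewrite (adj_sym G)|left].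
Qed.

Lemma hull_K2_ball : classical_sets.subset (convex_hull (edge_vectors R G))
  (K2_ball 1 : classical_sets.set point).
Proof.
apply: smallest_sub; first exact: K2_ball_convex.
move=> _ /edge_vectorP[c [v [cab cv [->|->]]]]; first exact: K2_ball_edge.
have := K2_ballZ (-1) (K2_ball_edge cab cv).
by rewrite normrN normr1 mulr1 scaleN1r.
Qed.

Lemma star_sumE S c (f : V -> R) w :
  (\sum_(v in S) f v *: (e v - e c)) w =
  (w \in S)%:R * f w - (w == c)%:R * \sum_(v in S) f v.
Proof.
rewrite sum_ffunE.
under eq_bigr do rewrite !ffunE /GRing.scale /= mulrBr.
rewrite sumrB; congr (_ - _); last first.
  by rewrite mulr_sumr; apply: eq_bigr => v _; rewrite mulrC.
have [wS|wS] := boolP (w \in S).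
  rewrite (bigD1 w) //= eqxx mulr1 mul1r big1 ?addr0 // => v /andP[_].
  by rewrite eq_sym => /negPf ->; rewrite mulr0.
rewrite mul0r big1 // => v vS.
by have -> : (w == v) = false; [apply: contraNF wS => /eqP ->|rewrite mulr0].
Qed.

Local Notation Q := (convex_hull (edge_vectors R G)).

Lemma hull_edge c v : G c v -> Q (e v - e c) /\ Q (- (e v - e c)).
Proof.
move=> cv; split; apply: sub_gen_smallest.
  by exists v, c; split=> //; rewrite (adj_sym G).
by exists c, v; split=> //; rewrite opprB.
Qed.

(** The origin is the midpoint of an edge vector and its opposite. *)
Lemma hull_origin c v : G c v -> Q 0.
Proof.
move=> /hull_edge[Q1 Q2].
have := (convex_setE Q).1 (@convex_hull_convex _ _ _) _ _ 2^-1 _ _ Q1 Q2.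
have -> : 1 - 2^-1 = 2^-1 :> R by lra.
by rewrite scalerN subrr; apply; lra.
Qed.

Lemma K2_ball_dilate c0 v0 r x : G c0 v0 -> K2_ball r x -> dilate Q r x.
Proof.
move=> /hull_origin Q0 [x0 xT xD xN xB].
have cQ : convex_set Q := @convex_hull_convex _ _ _.
have l1_ge0 S : 0 <= l1 S x by apply: sumr_ge0.
have edgeQ t c v : G c v -> dilate Q `|t| (t *: (e v - e c)).
  by move=> /hull_edge[Q1 Q2]; apply: dilate_scale_sym.
(* The common neighbour [v] sends [f v] to [a] and [x v - f v] to [b]; the flow
   bias not realised in this way is sent from [a] to [b] through one of them. *)
have [th th1 thr] := @clamp_exists _ (l1 D x) (- flow_bias x) (r - l1 L x)
  (l1_ge0 _) ltac:(lra) ltac:(rewrite normrN; lra).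
set w := - flow_bias x - th * l1 D x in thr.
pose f v : R := (x v + th * `|x v|) / 2.
(* As |th| <= 1, neither part [f v] nor [x v - f v] has sign opposite to [x v], so the splitting
   does not increase the cost. *)
have fE v : `|f v| + `|x v - f v| = `|x v|.
  rewrite /f; move: th1; rewrite ler_norml => /andP[th1 th2].
  have [xv|xv] := leP 0 (x v).
    rewrite (ger0_norm xv) [X in X + _]ger0_norm; last by nra.
    by rewrite ger0_norm; [lra|nra].
  rewrite (ltr0_norm xv) [X in X + _]ler0_norm; last by nra.
  by rewrite ler0_norm; [lra|nra].
have sumf : 2 * (\sum_(v in D) f v) = \sum_(v in D) x v + th * l1 D x.
  rewrite !mulr_sumr -big_split; apply: eq_bigr => v _ /=.
  by rewrite /f; field.
pose z : point := (w / 2) *: (e b - e a).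
have zQ : dilate Q `|w| z.
  have [D0|[d dD]] := set_0Vmem D.
    have -> : z = 0; last exact: dilate0.
    by rewrite /z /w xD // /l1 D0 big_set0 mulr0 oppr0 addr0 mul0r scale0r.
  (* The route through [d] uses two edges, each carrying |w|/2, for a total cost of |w|. *)
  have -> : z = (w / 2) *: (e d - e a) + (- (w / 2)) *: (e d - e b).
    by rewrite /z scaleNr -scalerN -scalerDr; congr (_ *: _);
       rewrite opprB [RHS]addrC subrKA.
  have -> : `|w| = `|w / 2| + `|- (w / 2)|.
    by rewrite normrN normf_div (ger0_norm (ler0n R 2)); lra.
  move: dD; rewrite inE => /andP[ad bd].
  by apply: dilate_add => //; apply: edgeQ.
have -> : x = \sum_(v in A) x v *: (e v - e a) + \sum_(v in B) x v *: (e v - e b) +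
   (\sum_(v in D) f v *: (e v - e a) + \sum_(v in D) (x v - f v) *: (e v - e b)) + z.
  apply/ffunP => v; rewrite !(ffunE, star_sumE) /GRing.scale /= sumrB.
  have [aA aB aD] := a_notin; have [bA bB bD] := b_notin.
  (* At [a] the equation amounts to the definition of the bias; at [b] the vanishing coordinate sum
     is used as well. *)
  have [->|va] := eqVneq v a.
    rewrite (negPf aA) (negPf aB) (negPf aD) (negPf ab).
    by move: sumf; rewrite /w /flow_bias /=; lra.
  have [->|vb] := eqVneq v b.
    rewrite (negPf bA) (negPf bB) (negPf bD).
    by move: sumf xT; rewrite /w /flow_bias /K2_sum /=; lra.
  have [vLD|vLD] := boolP (v \in L :|: D); last first.
    have xv0 : x v = 0.
      by apply: x0; rewrite finset.in_setU1 negb_or va finset.in_setU1 negb_or vb.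
    move: vLD; rewrite !finset.in_setU !negb_or =>
      /andP[/andP[/negPf -> /negPf ->] /negPf ->].
    by rewrite xv0 /=; lra.
  move: vLD; rewrite !inE; case: (G a v); case: (G b v) => //= _; lra.
have le_r : \sum_(v in A) `|x v| + \sum_(v in B) `|x v| +
    (\sum_(v in D) `|f v| + \sum_(v in D) `|x v - f v|) + `|w| <= r.
  rewrite -big_split /= (eq_bigr _ (fun v _ => fE v)) -sum_leaves.
  by rewrite -/(l1 L x) -/(l1 D x); lra.
have star S c g : {in S, forall v, G c v} ->
    dilate Q (\sum_(v in S) `|g v|) (\sum_(v in S) g v *: (e v - e c)).
  by move=> h; apply: dilate_sum => // v vS; apply: edgeQ; apply: h.
apply: dilate_le le_r _ => //; first by rewrite ?addr_ge0 ?sumr_ge0.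
by repeat (apply: dilate_add; rewrite ?addr_ge0 ?sumr_ge0 //);
  apply: star => v; rewrite inE => /andP[].
Qed.

Lemma K2_dilateE r : 0 <= r ->
  dilate (symmetric_edge_polytope R G) r = (K2_ball r : classical_sets.set point).
Proof.
move=> r0; rewrite /symmetric_edge_polytope; case: ifP =>
  [/existsP[u /existsP[v uv]]|noE].
  apply/seteqP; split=> [_ [p /hull_K2_ball pB <-]|x]; last exact: K2_ball_dilate uv.
  by have := K2_ballZ r pB; rewrite ger0_norm // mulr1.
(* Without edges all neighbour classes are empty; zero bias then forces x a = 0 and zero sum forces
   x b = 0, in agreement with the convention P_G = {0}. *)
have G0 u v : G u v = false.
  by apply: contraFF noE => uv; apply/existsP; exists u; apply/existsP; exists v.
have [A0 B0 D0] : [/\ A = finset.set0, B = finset.set0 & D = finset.set0].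
  by split; apply/setP => v; rewrite !inE !G0.
have L0 : L = finset.set0 by rewrite /L A0 B0 finset.setU0.
apply/seteqP; split=> [_ [p -> <-]|x [x0 xT /(_ D0) xD _ _]].
  have l10 S : l1 S (r *: (0 : point)) = 0.
    by apply: big1 => v _; rewrite scaler0 ffunE normr0.
  have s0 S : \sum_(v in S) (r *: (0 : point)) v = 0.
    by apply: big1 => v _; rewrite scaler0 ffunE.
  have z v : (r *: (0 : point)) v = 0 by rewrite scaler0 ffunE.
  by split=> [v _|| _||]; rewrite /flow_bias /K2_sum !(l10, s0, z, mulr0, addr0, normr0).
exists 0 => //; rewrite scaler0; apply/ffunP => v; rewrite ffunE.
move: xT xD; rewrite /K2_sum /flow_bias A0 B0 D0 !big_set0 => xT xD.
have [->|va] := eqVneq v a; first by lra.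
have [->|vb] := eqVneq v b; first by lra.
by rewrite x0 // L0 D0 !inE (negPf va) (negPf vb).
Qed.

End K2Polytope.

(** * Lattice points of the dilates *)

Lemma odd_abszD (x y : int) : odd `|x + y| = odd `|x|%N (+) odd `|y|%N.
Proof. by rewrite -oddD; lia. Qed.

Lemma odd_absz_doubleD (x y : int) : odd `|2 * x + y| = odd `|y|.
Proof. by lia. Qed.

Lemma odd_absz_sum (I : Type) (l : seq I) (f : I -> int) :
  odd `|\sum_(i <- l) f i| = odd (\sum_(i <- l) `|f i|)%N.
Proof.
elim: l => [|i l IH]; first by rewrite !big_nil.
by rewrite !big_cons odd_abszD IH oddD.
Qed.

Section K2Lattice.
Variables (R : realType) (V : finType) (G : sgraph V) (a b : V).
Hypothesis ab : a != b.
Hypothesis bipG : forall u v, G u v -> (u \in [set a; b]) != (v \in [set a; b]).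
Local Notation point := {ffun V -> R^o}.
Implicit Types (x : point) (y : {ffun V -> int}) (v : V) (S : {set V}).
Local Notation A := (leaves_a G a b).
Local Notation B := (leaves_b G a b).
Local Notation L := (leaves G a b).
Local Notation D := (common G a b).

(* Lattice points are encoded by their coordinates outside [a] and [b], together
   with their flow bias, which is stored as the coordinate at [a]. *)
Definition K2_code (s : nat) y : Prop :=
  [/\ (l1norm (enum L) y + l1norm (enum D) y <= s)%N,
      (l1norm (enum L) y + `|y a| <= s)%N,
      odd `|y a| = odd (l1norm (enum D) y),
      forall v, v \notin a |: (L :|: D) -> y v = 0 &
      D = finset.set0 -> y a = 0].

(** The values at [a] and [b] solve the linear equations that prescribe bias [y a] and coordinate
    sum zero. The parity condition in [K2_code] makes the halves integral. *)
Definition K2_decode y : point := [ffun v =>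
  if v == a then
    (y a - \sum_(u in D) y u)%:~R / 2 - (\sum_(u in A) y u)%:~R
  else if v == b then
    - (y a + \sum_(u in D) y u)%:~R / 2 - (\sum_(u in B) y u)%:~R
  else (y v)%:~R].

Lemma K2_decode_a y :
  K2_decode y a = (y a - \sum_(u in D) y u)%:~R / 2 - (\sum_(u in A) y u)%:~R.
Proof. by rewrite ffunE eqxx. Qed.

Lemma K2_decode_b y :
  K2_decode y b = - (y a + \sum_(u in D) y u)%:~R / 2 - (\sum_(u in B) y u)%:~R.
Proof. by rewrite ffunE eq_sym (negPf ab) eqxx. Qed.

Lemma K2_decode_notin S y : a \notin S -> b \notin S ->
  {in S, forall v, K2_decode y v = (y v)%:~R}.
Proof.
move=> aS bS v vS; rewrite ffunE.
case: eqP => [va|_]; first by rewrite va (negPf aS) in vS.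
by case: eqP => [vb|//]; rewrite vb (negPf bS) in vS.
Qed.

Lemma K2_decode_sum S y : a \notin S -> b \notin S ->
  \sum_(v in S) K2_decode y v = (\sum_(v in S) y v)%:~R :> R.
Proof.
move=> aS bS; rewrite rmorph_sum /=; apply: eq_bigr => v vS.
exact: K2_decode_notin vS.
Qed.

Lemma K2_decode_l1 S y : a \notin S -> b \notin S ->
  l1 S (K2_decode y) = (l1norm (enum S) y)%:R.
Proof.
move=> aS bS; rewrite /l1 /l1norm big_enum /= natr_sum; apply: eq_bigr => v vS.
by rewrite (K2_decode_notin _ aS bS) // natr_absz intr_norm.
Qed.

Let aABD := a_notin bipG.
Let bABD := b_notin bipG.

Let aL : a \notin L.
Proof. by case: aABD => aA aB _; rewrite finset.in_setU negb_or aA. Qed.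
Let bL : b \notin L.
Proof. by case: bABD => bA bB _; rewrite finset.in_setU negb_or bA. Qed.

Lemma K2_decode_bias y : flow_bias G a b (K2_decode y) = (y a)%:~R.
Proof.
have [aA aB aD] := aABD; have [bA bB bD] := bABD.
rewrite /flow_bias !K2_decode_sum // K2_decode_a rmorphB /=; lra.
Qed.

Lemma K2_decode_K2_sum y : K2_sum G a b (K2_decode y) = 0.
Proof.
have [aA aB aD] := aABD; have [bA bB bD] := bABD.
rewrite /K2_sum !K2_decode_sum // K2_decode_a K2_decode_b rmorphB rmorphD /=; lra.
Qed.

Lemma K2_decode_ball (s : nat) y : K2_code s y -> K2_ball G a b s%:R (K2_decode y).
Proof.
have [aA aB aD] := aABD; have [bA bB bD] := bABD.
move=> [yN yB _ y0 yD]; split.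
- move=> v; rewrite finset.in_setU1 negb_or => /andP[va].
  rewrite finset.in_setU1 negb_or => /andP[vb vLD].
  by rewrite ffunE (negPf va) (negPf vb) y0 // finset.in_setU1 negb_or va.
- exact: K2_decode_K2_sum.
- by move=> /yD ya; rewrite K2_decode_bias ya.
- by rewrite !K2_decode_l1 // -natrD ler_nat.
by rewrite K2_decode_l1 // K2_decode_bias -intr_norm -natr_absz -natrD ler_nat.
Qed.

Lemma K2_decode_int (s : nat) y : K2_code s y -> integer_points R V (K2_decode y).
Proof.
move=> [_ _ par _ _] v; apply/intrP.
(* Absolute values preserve parity, so [y a] is congruent mod 2 to the sum of [y] over [D]. *)
move: par; rewrite /l1norm -odd_absz_sum big_enum /=.
set d := \sum_(u in D) y u => par.
have [h hE] : exists h, y a = d + h + h by exists ((y a - d) %/ 2)%Z; lia.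
rewrite ffunE -/d hE.
case: eqP => _.
  exists (h - \sum_(u in A) y u); rewrite !(rmorphB, rmorphD) /=; lra.
case: eqP => _; last by exists (y v).
exists (- (d + h) - \sum_(u in B) y u).
by rewrite !(rmorphB, rmorphD, rmorphN) /=; lra.
Qed.

Lemma K2_decode_inj s y y' : K2_code s y -> K2_code s y' ->
  K2_decode y = K2_decode y' -> y = y'.
Proof.
move=> [_ _ _ y0 _] [_ _ _ y'0 _] e; apply/ffunP => v.
have [->|va] := eqVneq v a.
  by apply: (@intr_inj R); rewrite -!K2_decode_bias e.
have [vLD|vLD] := boolP (v \in L :|: D); last first.
  by rewrite y0 ?y'0 // finset.in_setU1 negb_or va.
have vb : (v == b) = false.
  apply: contraTF vLD => /eqP ->; case: bABD => _ _ bD.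
  by rewrite finset.in_setU negb_or bL.
apply: (@intr_inj R); have := congr1 (fun x : point => x v) e.
by rewrite !ffunE (negPf va) vb.
Qed.

Lemma K2_decode_surj (s : nat) x : K2_ball G a b s%:R x -> integer_points R V x ->
  exists2 y, K2_code s y & K2_decode y = x.
Proof.
have [aA aB aD] := aABD; have [bA bB bD] := bABD.
move=> [x0 xT xD xN xB] xint.
(* The coordinates of [x] are integers, so the floor merely lifts them to [int]; [ya] is then the
   bias of [x] computed there. *)
pose n v := Num.floor (x v).
have nE v : x v = (n v)%:~R by rewrite floorK.
pose ya := 2 * n a + 2 * \sum_(v in A) n v + \sum_(v in D) n v.
pose y : {ffun V -> int} :=
  [ffun v => if v == a then ya else if v \in L :|: D then n v else 0].
have yE S : S \subset L :|: D -> {in S, y =1 n}.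
  move=> SLD v vS; rewrite ffunE (fintype.subsetP SLD) //.
  case: eqP => // va; have := fintype.subsetP SLD _ vS.
  by rewrite va finset.in_setU (negPf aL) (negPf aD).
have sA : A \subset L :|: D.
  by apply: fintype.subset_trans (finset.subsetUl _ _); apply: finset.subsetUl.
have sB : B \subset L :|: D.
  by apply: fintype.subset_trans (finset.subsetUl _ _); apply: finset.subsetUr.
have sL : L \subset L :|: D := finset.subsetUl _ _.
have sD : D \subset L :|: D := finset.subsetUr _ _.
have sumE S : S \subset L :|: D -> \sum_(v in S) y v = \sum_(v in S) n v.
  by move=> SLD; apply: eq_bigr => v /(yE _ SLD).
have sumxE S : \sum_(v in S) x v = (\sum_(v in S) n v)%:~R.
  by rewrite rmorph_sum; apply: eq_bigr => v _; rewrite nE.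
have yaE : y a = ya by rewrite ffunE eqxx.
have yx : K2_decode y = x.
  apply/ffunP => v; rewrite ffunE !sumE // yaE.
  have [->|va] := eqVneq v a.
    by rewrite nE /ya !(rmorphB, rmorphD, rmorphM) /=; lra.
  have [->|vb] := eqVneq v b.
    have : x b = - x a - \sum_(v in A) x v - \sum_(v in B) x v - \sum_(v in D) x v.
      by move: xT; rewrite /K2_sum; lra.
    move=> ->; rewrite !sumxE nE /ya !(rmorphB, rmorphD, rmorphM) /=; lra.
  rewrite ffunE (negPf va); case: ifP => [_|vLD]; first by rewrite -nE.
  by rewrite x0 // finset.in_setU1 negb_or va finset.in_setU1 negb_or vb vLD.
exists y => //; split.
- by rewrite -(ler_nat R) natrD -!K2_decode_l1 // yx.
- by rewrite -(ler_nat R) natrD -!K2_decode_l1 // natr_absz intr_norm -K2_decode_bias yx.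
- by rewrite /l1norm -odd_absz_sum big_enum /= sumE // yaE /ya -mulrDr odd_absz_doubleD.
- move=> v; rewrite finset.in_setU1 negb_or => /andP[va vLD].
  by rewrite ffunE (negPf va) (negPf vLD).
by move=> /xD; rewrite -yx K2_decode_bias => /eqP; rewrite intr_eq0 => /eqP.
Qed.

(** Without common neighbours the bias must be 0, whereas [K2_points] with an empty [D] would allow
    every even bias within the budget; hence two enumerations. *)
Definition K2_codes (s : nat) : seq {ffun V -> int} :=
  if D == finset.set0 then points (@origin_base V) (enum L) s
  else K2_points a (enum D) (enum L) s.

Let uDL : uniq (a :: enum D ++ enum L).
Proof.
have [aA aB aD] := aABD.
rewrite /= mem_cat !mem_enum negb_or aD aL cat_uniq !enum_uniq andbT /=.
rewrite andbT; apply/hasPn => v; rewrite !mem_enum !inE.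
by case: (G a v); case: (G b v).
Qed.

Lemma K2_codes_uniq s : uniq (K2_codes s).
Proof.
rewrite /K2_codes; case: ifP => _; first exact/points_origin_uniq/enum_uniq.
exact: K2_points_uniq.
Qed.

Lemma mem_K2_codes s y : y \in K2_codes s <-> K2_code s y.
Proof.
rewrite /K2_codes; case: eqP => D0.
  rewrite mem_points_origin ?enum_uniq //.
  have l0 : l1norm (enum D) y = 0%N by rewrite D0 enum_set0 /l1norm big_nil.
  split=> [/andP[yN /forallP y0]|[yN _ _ y0 yD]].
    have y0' v : v \notin L -> y v = 0.
      by move=> vL; apply/eqP; have := y0 v; rewrite mem_enum vL.
    have ya : y a = 0 by apply: y0'.
    split; rewrite ?l0 ?ya ?addn0 // => v.
    by rewrite finset.in_setU1 !finset.in_setU !negb_or -negb_or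
      -finset.in_setU => /and3P[_ /y0'].
  rewrite l0 addn0 in yN; rewrite yN; apply/forallP => v; apply/implyP.
  rewrite mem_enum => vL; apply/eqP; have [->|va] := eqVneq v a; first exact: yD.
  by apply: y0; rewrite finset.in_setU1 negb_or va D0 finset.setU0.
rewrite mem_K2_points //; split=> [/and4P[yN yB /eqP par /forallP y0]|[yN yB par y0 _]].
  split=> // v vN; apply/eqP; have := y0 v; rewrite inE mem_cat !mem_enum.
  by rewrite finset.in_setU1 finset.in_setU in vN; rewrite [X in _ || X]orbC vN.
rewrite yN yB par eqxx; apply/forallP => v; apply/implyP.
rewrite inE mem_cat !mem_enum => vN; apply/eqP/y0.
by rewrite finset.in_setU1 finset.in_setU [X in _ || X]orbC.
Qed.

Local Open Scope classical_set_scope.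
Local Open Scope card_scope.

Lemma card_lattice_points (s : nat) :
  [set s%:R *: x | x in symmetric_edge_polytope R G] `&` integer_points R V
    #= `I_(size (K2_codes s)).
Proof.
have -> : [set s%:R *: x | x in symmetric_edge_polytope R G] `&` integer_points R V
    = [set K2_decode y | y in [set y | K2_code s y]].
  rewrite -/(dilate _ _) (K2_dilateE ab bipG) ?ler0n //.
  apply/seteqP; split=> [x [xB xint]|_ [y yC <-]].
    by have [y yC <-] := K2_decode_surj xB xint; exists y.
  by split; [apply: K2_decode_ball|apply: K2_decode_int yC].
apply: (card_eq_trans (inj_card_eq _)).
  by move=> y y' /set_mem yC /set_mem y'C; apply: K2_decode_inj yC y'C.
have -> : [set y | K2_code s y] = [set` K2_codes s].
  by apply/seteqP; split=> y /mem_K2_codes.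
pose y0 : {ffun V -> int} := [ffun=> 0].
apply: card_esym.
have <- : [set nth y0 (K2_codes s) i | i in `I_(size (K2_codes s))] = [set` K2_codes s].
  apply/seteqP; split=> [_ [i /= si <-]|y /= yC]; first exact: mem_nth.
  by exists (index y (K2_codes s)); rewrite /= ?index_mem ?nth_index.
apply: card_esym; apply: inj_card_eq => i j; rewrite !inE /= => si sj /eqP.
by rewrite nth_uniq ?K2_codes_uniq // => /eqP.
Qed.

Lemma size_K2_codes0 (F : numFieldType) s : D = finset.set0 ->
  (size (K2_codes s))%:R = (cross_poly F #|L|).[s%:R].
Proof. by move=> D0; rewrite /K2_codes D0 eqxx size_points_origin -cardE. Qed.

Lemma size_K2_codes (F : numFieldType) s : D != finset.set0 ->
  2 * (size (K2_codes s))%:R =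
  #|D|.+1%:R * (cross_poly F (#|D| + #|L|).+1).[s%:R] -
  #|D|.-1%:R * (cross_poly F (#|D| + #|L|).-1).[s%:R].
Proof.
move=> D0; rewrite /K2_codes (negPf D0) size_K2_points -?cardE //.
by apply: contraNneq D0 => D0; rewrite -cards_eq0 cardE D0.
Qed.

End K2Lattice.

(** * Identification of the Ehrhart polynomial and conclusion *)

Lemma horner_nat_inj (F : numFieldType) (p q : {poly F}) :
  (forall s : nat, p.[s%:R] = q.[s%:R]) -> p = q.
Proof.
move=> pq; apply/eqP; rewrite -subr_eq0; apply/eqP.
apply: (@roots_geq_poly_eq0 _ _ [seq i%:R | i <- iota 0 (size (p - q))]).
- by apply/allP => _ /mapP[i _ ->]; rewrite rootE !hornerE pq subrr.
- by rewrite map_inj_uniq ?iota_uniq // => i j /eqP; rewrite eqr_nat => /eqP.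
by rewrite size_map size_iota.
Qed.

Theorem theorem4p12 (R : realType) (V : finType) (G : sgraph V) (n : nat)
    (hG : bipartite_of_type G 2 n)
    (H : {poly R[i]})
    (hH : is_ehrhart_polynomial (symmetric_edge_polytope R G) H)
    (z : R[i]) (hz : root H z) :
  complex.Re z = - 2^-1.
Proof.
have [S [/eqP/cards2P[a [b [ab SE]]] _ bipG]] := hG; rewrite {}SE in bipG.
have HE s : H.[s%:R] = (size (K2_codes G a b s))%:R.
  have [k cardk ->] := hH s; congr _%:R; apply/card_eq_II.
  exact: card_eq_trans (card_esym cardk) (card_lattice_points R ab bipG s).
apply: Re_eq_opp_half; move/rootP: hz => Hz.
have [D0|D0] := eqVneq (common G a b) finset.set0.
  have HC : H = cross_poly R[i] #|leaves G a b|.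
    by apply: horner_nat_inj => s; rewrite HE size_K2_codes0.
  by apply: (@cross_poly_root _ #|leaves G a b|); rewrite /root -HC Hz.
(* The index [d] is chosen so that m + k = d+1 for k leaves; then 2H combines C_(d+2) and C_d, as
   [cross_poly_comb_root] expects. *)
set m := #|common G a b|; set d := (m + #|leaves G a b|).-1%N.
have m0 : (0 < m)%N by rewrite card_gt0.
have dE : (m + #|leaves G a b|)%N = d.+1 by rewrite prednK // ltn_addr.
have HC : 2 *: H = m.+1%:R *: cross_poly R[i] d.+2 - m.-1%:R *: cross_poly R[i] d.
  apply: horner_nat_inj => s.
  by rewrite hornerD hornerN !hornerZ HE size_K2_codes // -/m dE.
apply: (@cross_poly_comb_root _ m d) => //; first by rewrite -dE ltnW // ltnS leq_addr.
have := congr1 (fun p : {poly R[i]} => p.[z]) HC.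
rewrite hornerD hornerN !hornerZ Hz mulr0 => /esym/eqP.
by rewrite subr_eq0 => /eqP.
Qed.
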